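(* Let $K$ be a random compact subset of the square $[0,1]\times[0,1]$ such that, almost surely, the first projection $\{x\in[0,1] : \exists\, y\in[0,1]\ (x,y)\in K\}$ of $K$ is uncountable. Then for every $\varepsilon>0$ there exists a (nonrandom) continuous function $f:[0,1]\to[0,1]$ such that $$\mathbb{P}\big(K\cap G_f\neq\emptyset\big)\ge 1-\varepsilon,$$ where $G_f=\{(x,f(x)) : 0\le x\le 1\}$ is the graph of $f$.
   Context: A random compact subset of $[0,1]\times[0,1]$ is a random element, defined on some probability space, of the space of compact subsets of $[0,1]\times[0,1]$ (with its usual Borel $\sigma$-field, generated by the events $\{K\cap F\ne\emptyset\}$ for $F$ compact). ''Uncountable'' means neither finite nor countably infinite. *)

(* Defs.v *)
From HB Require Import structures.
From mathcomp Require Import all_boot all_order all_algebra.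
From mathcomp Require Import all_classical all_reals all_analysis.

Set Implicit Arguments.
Unset Strict Implicit.
Unset Printing Implicit Defensive.

Import Order.TTheory GRing.Theory Num.Theory.
Import numFieldNormedType.Exports.

Local Open Scope classical_set_scope.
Local Open Scope ring_scope.

Definition unit_square (R : realType) : set (R * R) := `[0, 1] `*` `[0, 1].

(* The empty set is allowed. *)
Record compact_subset (R : realType) := CompactSubset {
  set_of_compact_subset :> set (R * R) ;
  compact_subset_compact : compact set_of_compact_subset ;
  compact_subset_sub : set_of_compact_subset `<=` @unit_square R }.

Lemma sub0_unit_square (R : realType) : set0 `<=` @unit_square R.
Proof. exact: sub0set. Qed.

HB.instance Definition _ (R : realType) := gen_eqMixin (compact_subset R).
HB.instance Definition _ (R : realType) := gen_choiceMixin (compact_subset R).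
HB.instance Definition _ (R : realType) := isPointed.Build (compact_subset R)
  (CompactSubset (@compact0 (R * R)%type) (@sub0_unit_square R)).

Definition hitting_sets (R : realType) : set (set (compact_subset R)) :=
  [set [set K : compact_subset R | K `&` F !=set0] |
    F in [set F : set (R * R) | compact F /\ F `<=` @unit_square R]].

(* The compact subsets of the unit square, with the sigma-algebra generated by
   the hitting events, i.e. the Borel sigma-algebra of the Hausdorff metric. *)
Definition compact_subset_space (R : realType) :=
  g_sigma_algebraType (@hitting_sets R).

Definition graph01 (R : realType) (f : R -> R) : set (R * R) :=
  [set (x, f x) | x in `[0, 1]].

(* Main.v *)
Require Import Defs.
From HB Require Import structures.
From mathcomp Require Import all_boot all_order all_algebra.
From mathcomp Require Import all_classical all_reals all_analysis.
From mathcomp Require Import measurable_realfun ring lra.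

Import Order.TTheory GRing.Theory Num.Theory.
Import numFieldNormedType.Exports.

Set Implicit Arguments.
Unset Strict Implicit.

Local Open Scope classical_set_scope.
Local Open Scope ring_scope.

(** The function f is a limit of continuous functions f_n with
|f_(n+1) - f_n| <= delta_n / 2, where delta_n halves at each stage, and the
invariant is that, outside an exceptional event of controlled size, the part
of K in the tube |y - f_n(x)| <= delta_n still has an uncountable projection.
In the limit these compact parts shrink to K meeting the graph of f.

The passage from f_n to f_(n+1) (lemma [refine]) is where uncountability is
used.  Cut [0, 1] into m cells and move f_n up or down by delta_n / 2,
independently on each cell, with a continuous transition near the cell ends
([wave]).  Over a cell where the part of K in the tube has an uncountable
projection, at least one of the upper and lower half-tubes keeps an
uncountable projection, so one of the two signs is right
([half_tube]).  An uncountable set meets arbitrarily many cells in an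
uncountable set when m is large ([nb_uncountable_cells]); if there are N such
cells, then at most a fraction 2^-N of the sign vectors are wrong everywhere.
Averaging over the sign vectors gives one deterministic vector that is right
with a probability as close as desired to the previous one.

Having an uncountable projection is an analytic condition on a compact set, not
a Borel one, so the events in the invariant need not be measurable.  They are
therefore measured from outside: [outer_ge P c A] says that the outer
probability of A is at least c.  Two facts suffice: outer
probability is continuous along increasing sequences of arbitrary sets
([outer_ge_bigcup]), and the averaging argument survives because it only needs
measurable sets covering the favourable events ([outer_ge_average]).  The final
event is measurable, and there outer probability is probability. *)

(** * Uncountable sets of reals *)

Lemma uncountable_sub (T : Type) (A B : set T) :
  A `<=` B -> ~ countable A -> ~ countable B.
Proof. by move=> AB; apply: contra_not; exact/sub_countable/subset_card_le. Qed.

Lemma countableU (T : Type) (A B : set T) :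
  countable A -> countable B -> countable (A `|` B).
Proof.
move=> cA cB; rewrite -bigcup2E; apply: bigcup_countable => // -[|[|i]] _ //=.
Qed.

Lemma uncountable_bigcup (I : countType) (T : Type) (F : I -> set T) :
  ~ countable (\bigcup_i F i) -> exists i, ~ countable (F i).
Proof.
move=> ncF; apply: contrapT => /forallNP cF; apply: ncF.
by apply: bigcup_countable => [|i _]; [exact: countableP|exact: contrapT].
Qed.

(** Delete from A every part of A on one side of a rational that is countable.
If no pair a < b were as required, then two of the remaining points would be
separated by rationals a < b one of which cuts off a countable part containing
one of these points; so at most one point would remain. *)
Lemma uncountable_split (R : realType) (A : set R) : ~ countable A ->
  exists a b, [/\ a < b, ~ countable (A `&` [set x | x <= a]) &
                         ~ countable (A `&` [set x | b <= x])].
Proof.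
move=> ncA; apply: contrapT => nsplit.
pose L (q : rat) := A `&` [set x | x <= ratr q].
pose U (q : rat) := A `&` [set x | ratr q <= x].
pose C := (\bigcup_(q in [set q | countable (L q)]) L q) `|`
          (\bigcup_(q in [set q | countable (U q)]) U q).
have cC : countable C.
  by apply: countableU; apply: bigcup_countable => // ; exact: countableP.
suff [x0 Dx0] : exists x0, A `\` C `<=` [set x0].
  apply: ncA; apply: (@sub_countable _ _ _ (C `|` [set x0])); last first.
    by apply: countableU => //; exact: countable1.
  apply: subset_card_le => x Ax; have [Cx|nCx] := pselect (C x); first by left.
  by right; apply: Dx0.
have [[x0 Dx0]|/set0P/negP/negPn/eqP ->] := pselect (A `\` C !=set0); last first.
  by exists 0 => x.
exists x0 => y Dy /=.
wlog xy : x0 y Dx0 Dy / x0 <= y.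
  by move=> W; have [/W->//|/ltW/W->] := leP x0 y.
apply/eqP; rewrite eq_le xy andbT leNgt; apply/negP => {}xy.
have [a] := rat_in_itvoo xy; rewrite in_itv /= => /andP[x0a ay].
have [b] := rat_in_itvoo ay; rewrite in_itv /= => /andP[ab yb].
apply: nsplit; exists (ratr a), (ratr b); split => // cL.
  by case: Dx0 => Ax0; apply; left; exists a => //; split => //; exact: ltW.
by case: Dy => Ay; apply; right; exists b => //; split => //; exact: ltW.
Qed.

(** * A grid of cells *)

Section Cells.
Variable R : realType.
Implicit Types (A : set R) (m j p : nat) (x : R).

(** For m > 0, positive exactly on the open interval ]j / m, (j + 1) / m[. *)
Definition tent m j x : R := Num.min (m%:R * x - j%:R) (j.+1%:R - m%:R * x).

Definition cell m j : set R := [set x | 0 < tent m j x].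

(** The closed subinterval of the cell where the bump of height 1 defined below
has reached its plateau; the cores exhaust the cell as p grows. *)
Definition core m p j : set R := [set x | 1 <= p.+1%:R * tent m j x].

Definition nb_uncountable m (F : nat -> set R) A : nat :=
  #|[pred j : 'I_m | `[< ~ countable (A `&` F j) >]]|.

Lemma cellP m j x : cell m j x <-> j%:R < m%:R * x < j.+1%:R.
Proof. by rewrite /cell /= /tent lt_min !subr_gt0. Qed.

Lemma cell_inj m i j x : cell m i x -> cell m j x -> i = j.
Proof.
move=> /cellP/andP[ix xi] /cellP/andP[jx xj].
have := lt_trans ix xj; have := lt_trans jx xi; rewrite !ltr_nat !ltnS => ji ij.
by apply/eqP; rewrite eqn_leq ij ji.
Qed.

Lemma uncountable_cell m A : (0 < m)%N -> A `<=` `[0, 1] -> ~ countable A ->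
  exists j : 'I_m, ~ countable (A `&` cell m j).
Proof.
move=> m0 A01 ncA; apply: uncountable_bigcup => cU; apply: ncA.
apply: (@sub_countable _ _ _ ((\bigcup_(j : 'I_m) (A `&` cell m j)) `|`
   range (fun j : nat => j%:R / m%:R))); last first.
  by apply: countableU => //; apply: card_image_le.
apply: subset_card_le => x Ax.
have := A01 _ Ax; rewrite /= in_itv /= => /andP[x0 x1].
have mx0 : 0 <= m%:R * x by rewrite mulr_ge0.
have /andP[jx xj] := truncn_itv mx0.
move: jx; rewrite le_eqVlt => /predU1P[jx|jx].
  right; exists (Num.truncn (m%:R * x)) => //=.
  by rewrite jx mulrAC mulfV ?mul1r// pnatr_eq0 -lt0n.
left; have jm : (Num.truncn (m%:R * x)%R < m)%N.
  by rewrite -(ltr_nat R) (lt_le_trans jx)// ler_piMr.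
by exists (Ordinal jm) => //; split => //; apply/cellP; rewrite jx.
Qed.

(** By induction on N: split A into a part left of a and a part right of b > a.
The right part provides N cells, the left part one more, and no cell of length
less than b - a meets both parts.  The bound holds for all large m, not just
for one m, which makes the corresponding events increase with m0. *)
Lemma nb_uncountable_cells N A : A `<=` `[0, 1] -> ~ countable A ->
  exists m0, forall m, (m0 <= m)%N -> (N <= nb_uncountable m (cell m) A)%N.
Proof.
elim: N A => [|N IH] A A01 ncA; first by exists 0%N.
have [a [b [ab ncL ncU]]] := uncountable_split ncA.
have [m0 Hm0] := IH _ (subset_trans (@subIsetl _ _ _) A01) ncU.
exists (maxn m0 (Num.truncn (b - a)^-1).+1) => m.
rewrite geq_max => /andP[m0m am].
have mba : 1 < m%:R * (b - a).
  have ba : 0 < b - a by rewrite subr_gt0.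
  rewrite -ltr_pdivrMr// div1r (lt_le_trans (truncnS_gt _))//.
  by rewrite ler_nat.
have [|j ncj] := uncountable_cell (leq_ltn_trans (leq0n _) am) _ ncL.
  exact: subset_trans (@subIsetl _ _ _) A01.
apply: (@leq_trans #|[predU1 j & [pred j : 'I_m |
    `[< ~ countable (A `&` [set x | b <= x] `&` cell m j) >]]]|); last first.
  apply: subset_leq_card; apply/fintype.subsetP => i; rewrite !inE.
  case/predU1P => [->|/asboolP nci].
    by apply: (uncountable_sub _ ncj) => x [[]].
  by apply: (uncountable_sub _ nci) => x [[]].
rewrite cardU1 -add1n leq_add //; last exact: Hm0.
rewrite lt0b inE; apply/asboolP => ncj'.
have [x [[_ xa] /cellP/andP[jx xj]]] : A `&` [set x | x <= a] `&` cell m j !=set0.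
  by apply/set0P/eqP => E; apply: ncj; rewrite E.
have [y [[_ yb] /cellP/andP[jy yj]]] : A `&` [set x | b <= x] `&` cell m j !=set0.
  by apply/set0P/eqP => E; apply: ncj'; rewrite E.
have : m%:R * (b - a) <= m%:R * (y - x).
  by apply: ler_wpM2l => //; apply: lerB.
move: jx yj mba; rewrite !mulrBr -natr1; lra.
Qed.

Lemma sub_core m p q j : (p <= q)%N -> core m p j `<=` core m q j.
Proof.
move=> pq x; rewrite /core /= => /[dup] p1 /le_trans; apply.
have t0 : 0 < tent m j x by rewrite -(pmulr_rgt0 _ (ltr0Sn R p)) (lt_le_trans _ p1).
by rewrite ler_wpM2r ?ler_nat// ltW.
Qed.

Lemma bigcup_core m j : \bigcup_p core m p j = cell m j.
Proof.
apply/seteqP; split => x /=.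
  move=> [p _]; rewrite /core /= => p1.
  by rewrite /cell /= -(pmulr_rgt0 _ (ltr0Sn R p)) (lt_le_trans _ p1).
move=> t0; exists (Num.truncn (tent m j x)^-1) => //=.
by rewrite /core /= -ler_pdivrMr// div1r ltW// truncnS_gt.
Qed.

Lemma nb_uncountable_cores m A :
  exists p, (nb_uncountable m (cell m) A <= nb_uncountable m (core m p) A)%N.
Proof.
have H (j : 'I_m) : exists p, ~ countable (A `&` cell m j) ->
    ~ countable (A `&` core m p j).
  have [c|nc] := pselect (countable (A `&` cell m j)); first by exists 0%N.
  move: nc; rewrite -bigcup_core setI_bigcupr => /uncountable_bigcup[p ncp].
  by exists p.
have {H}[p Hp] := choice H; exists (\max_(j < m) p j)%N.
apply/subset_leq_card/fintype.subsetP => j; rewrite !inE => /Hp ncj.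
apply: (uncountable_sub _ ncj); apply: setIS; apply: sub_core.
exact: leq_bigmax.
Qed.

Lemma le_nb_uncountable_core m p q A : (p <= q)%N ->
  (nb_uncountable m (core m p) A <= nb_uncountable m (core m q) A)%N.
Proof.
move=> pq; apply/subset_leq_card/fintype.subsetP => j; rewrite !inE => ncj.
by apply: (uncountable_sub _ ncj); apply: setIS; exact: sub_core.
Qed.

End Cells.

(** * Outer probability *)

Section OuterProbability.
Context d (T : measurableType d) (R : realType) (P : probability T R).
Implicit Types (A B : set T) (c : R).

Definition outer_ge c A : Prop :=
  forall B, measurable B -> A `<=` B -> (c%:E <= P B)%E.

Lemma outer_ge_sub c A A' : A `<=` A' -> outer_ge c A -> outer_ge c A'.
Proof. by move=> AA' cA B mB A'B; apply: cA => //; apply: subset_trans A'B. Qed.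

Lemma outer_ge_le1 c A : outer_ge c A -> c <= 1.
Proof.
by move=> /(_ setT measurableT (fun _ _ => Logic.I)); rewrite probability_setT lee_fin.
Qed.

Lemma outer_geN c A : ~ outer_ge c A ->
  exists B, [/\ measurable B, A `<=` B & (P B < c%:E)%E].
Proof.
move=> /existsNP[B /not_implyP[mB /not_implyP[AB /negP]]]; rewrite -ltNge => PB.
by exists B.
Qed.

(** If every A n had a measurable cover B n of probability less than c', then so
would have the increasing covers \bigcap_(k >= n) B k, and their union would
cover \bigcup_n A n with probability at most c'. *)
Lemma outer_ge_bigcup c c' (A : (set T)^nat) : c' < c -> nondecreasing_seq A ->
  outer_ge c (\bigcup_n A n) -> exists n, outer_ge c' (A n).
Proof.
move=> c'c ndA cA; apply: contrapT => /forallNP nA.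
have {nA}[B HB] := choice (fun n => outer_geN (nA n)).
pose C n := \bigcap_(k in [set k | (n <= k)%N]) B k.
have mB n : measurable (B n) by case: (HB n).
have mC n : measurable (C n).
  rewrite /C bigcap_mkcond; apply: bigcapT_measurable => k.
  by case: ifPn => // _; exact: mB.
have AC n : A n `<=` C n.
  move=> w Aw k /= nk; have [_ + _] := HB k; apply.
  by move/subsetPset : (ndA _ _ nk); apply.
have ndC : nondecreasing_seq C.
  move=> n m nm; apply/subsetPset => w Cw k /= mk; apply: Cw => /=.
  exact: leq_trans mk.
have mUC : measurable (\bigcup_n C n) by exact: bigcup_measurable.
have cvgC := nondecreasing_cvg_mu (mu := P) mC mUC ndC.
have : (P (\bigcup_n C n) <= c'%:E)%E.
  rewrite -(cvg_lim _ cvgC)//; apply: lime_le.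
    by apply/cvg_ex; eexists; exact: cvgC.
  apply: nearW => n /=; have [_ _ /ltW] := HB n; apply: le_trans.
  by apply: le_measure; rewrite ?inE// => w; apply => /=.
apply/negP; rewrite -ltNge (lt_le_trans (y := c%:E))// ?lte_fin//.
by apply: cA => // w [n _ /AC]; exists n.
Qed.

(** If every E i had a measurable cover B i of probability less than c', then A
would lie in the measurable set where at least k of the B i occur; integrating
the number of occurrences over that set gives k * c <= \sum_i P (B i), which is
less than c' * #|I|. *)
Lemma outer_ge_average (I : finType) (E : I -> set T) A c c' (k : nat) :
  (0 < #|I|)%N -> outer_ge c A ->
  (forall w, A w -> (k <= #|[pred i | `[< E i w >]]|)%N) ->
  c' * #|I|%:R <= k%:R * c ->
  exists i, outer_ge c' (E i).
Proof.
move=> I0 cA kA c'c; apply: contrapT => /forallNP nE.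
have {nE}[B HB] := choice (fun i => outer_geN (nE i)).
have mB i : measurable (B i) by case: (HB i).
pose h w : R := \sum_i \1_(B i) w.
have mh : measurable_fun setT h.
  by apply: measurable_sum => i; exact: measurable_indic.
have mG : measurable (h @^-1` `[k%:R, +oo[) by rewrite -[_ @^-1` _]setTI; exact: mh.
set G := h @^-1` _ in mG.
have AG : A `<=` G.
  move=> w /kA kw; rewrite /G /= in_itv /= andbT /h.
  rewrite -(ler_nat R) in kw; apply: (le_trans kw).
  rewrite -sum1_card natr_sum big_mkcond /=; apply: ler_sum => i _.
  rewrite inE; case: ifPn => [/asboolP Ew|_]; last by rewrite indicE ler0n.
  by rewrite indicE mem_set//; case: (HB i) => _ + _; apply.
have : ((k%:R * c)%:E <= \sum_i P (B i))%E.
  rewrite EFinM (@le_trans _ _ (k%:R%:E * P G)%E)//.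
    by apply: lee_wpmul2l; [rewrite lee_fin|exact: cA].
  rewrite -(integral_cst P mG) (@le_trans _ _ (\int[P]_(w in G) (h w)%:E)%E)//.
    apply: ge0_le_integral => //.
    - by move=> w _; rewrite lee_fin.
    - exact/measurable_EFinP/measurable_funTS.
    - by move=> w; rewrite /G /= in_itv /= andbT lee_fin.
  under eq_integral do rewrite -sumEFin.
  rewrite ge0_integral_sum//; last first.
    by move=> i; exact/measurable_EFinP/measurable_indic.
  by apply: lee_sum => i _; rewrite integral_indic// le_measure ?inE//;
    exact: measurableI.
have fP i : P (B i) = (fine (P (B i)))%:E by rewrite fineK// fin_num_measure.
under eq_bigr do rewrite fP.
rewrite sumEFin lee_fin; apply/negP; rewrite -ltNge.
apply: lt_le_trans c'c; rewrite mulr_natr -sumr_const; apply: ltr_sum.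
  by have /card_gt0P[i _] := I0; apply/hasP; exists i => //; rewrite mem_index_enum.
by move=> i _; rewrite -lte_fin -fP; case: (HB i).
Qed.

End OuterProbability.

(** * Sign vectors and waves *)

(** The sign vectors that differ from b at every place of D are determined by
their values outside D. *)
Lemma card_sign_match m N (D : pred 'I_m) (b : 'I_m -> bool) : (N <= #|D|)%N ->
  (2 ^ m - 2 ^ (m - N) <=
   #|[pred s : {ffun 'I_m -> bool} | [exists j in D, s j == b j]]|)%N.
Proof.
move=> ND; set good := (X in (_ <= #|X|)%N).
have cardT : #|{: {ffun 'I_m -> bool}}| = (2 ^ m)%N.
  by rewrite card_ffun card_bool card_ord.
rewrite leq_subLR -cardT -(cardC good) addnC leq_add2r.
pose F (j : 'I_m) := if j \in D then pred1 (~~ b j) else predT.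
rewrite (@eq_card _ _ (mem (family F : simpl_pred {ffun 'I_m -> bool}))); last first.
  move=> s; rewrite !inE; apply/idP/familyP => [/existsPn Hs j|Hs].
    have := Hs j; rewrite /F; case: ifP => jD; last by [].
    by rewrite /= inE; case: (s j) (b j) => -[].
  apply/existsPn => j; have := Hs j; rewrite /F; case: ifP => //= jD.
  by rewrite inE => /eqP ->; case: (b j).
rewrite (card_family F) foldrE big_map big_enum /=.
rewrite (bigID (mem D)) /= big1 ?mul1n; last first.
  by move=> j jD; rewrite /F jD card1.
rewrite (eq_bigr (fun=> 2%N)); last first.
  by move=> j jD; rewrite /F (negbTE jD) card_bool.
rewrite prod_nat_const leq_pexp2l//.
have cD : (#|D| + #|[predC D]|)%N = m by rewrite cardC card_ord.
have Nm : (N <= m)%N by rewrite -[m in (_ <= m)%N]cD (leq_trans ND)// leq_addr.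
by rewrite leq_subRL// -[m in (_ <= m)%N]cD leq_add2r.
Qed.

Section Wave.
Variable R : realType.
Implicit Types (m j p : nat) (x : R).

Definition bump m p j x : R := Num.min 1 (Num.max 0 (p.+1%:R * tent m j x)).

(** A continuous function equal to 1 or -1 on the core of each cell, according
to the sign vector, and vanishing at the ends of the cells. *)
Definition wave m p (s : {ffun 'I_m -> bool}) x : R :=
  \sum_(j < m) (-1) ^+ s j * bump m p j x.

Lemma bump_out m p j x : ~ cell m j x -> bump m p j x = 0.
Proof.
move=> /negP; rewrite -leNgt => t0.
by rewrite /bump max_l ?min_r ?ler01// pmulr_rle0.
Qed.

Lemma wave_in m p s (j : 'I_m) x : cell m j x ->
  wave p s x = (-1) ^+ s j * bump m p j x.
Proof.
move=> cj; rewrite /wave (bigD1 j)//= big1 ?addr0// => i ij.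
rewrite bump_out ?mulr0// => ci; move/eqP: ij; apply.
exact/val_inj/(cell_inj ci cj).
Qed.

Lemma wave_core m p s (j : 'I_m) x : core m p j x -> wave p s x = (-1) ^+ s j.
Proof.
move=> cj; have cellj : cell m j x by rewrite -(bigcup_core R m j); exists p.
by rewrite (wave_in p s cellj) /bump max_r ?min_l ?mulr1//; apply: le_trans cj.
Qed.

Lemma wave_le1 m p (s : {ffun 'I_m -> bool}) x : `|wave p s x| <= 1.
Proof.
have [[j cj]|nc] := pselect (exists j : 'I_m, cell m j x); last first.
  rewrite /wave big1 ?normr0 ?ler01// => j _; rewrite bump_out ?mulr0// => cj.
  by apply: nc; exists j.
rewrite (wave_in p s cj) normrM normrX normrN1 expr1n mul1r ger0_norm.
  by rewrite ge_min lexx.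
by rewrite le_min ler01 le_max lexx.
Qed.

Lemma wave_continuous m p (s : {ffun 'I_m -> bool}) : continuous (wave p s).
Proof.
move=> x; apply: cvg_big => [|j _]; first exact: add_continuous.
apply: cvgM; first exact: cvg_cst.
have cm : {for x, continuous (fun x => m%:R * x : R)}.
  by apply: cvgM; [exact: cvg_cst|exact: cvg_id].
have ct : {for x, continuous (@tent R m j)}.
  by apply: (@continuous_min R _ (fun x => m%:R * x - j%:R)
    (fun x => j.+1%:R - m%:R * x)); apply: cvgB => //; exact: cvg_cst.
apply: (@continuous_min R _ (cst 1) (fun x => Num.max 0 (p.+1%:R * tent m j x))).
  exact: cvg_cst.
apply: (@continuous_max R _ (cst 0) (fun x => p.+1%:R * tent m j x)).
  exact: cvg_cst.
by apply: cvgM => //; exact: cvg_cst.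
Qed.

End Wave.

(** * Refining a tube *)

Section Refinement.
Variable R : realType.
Implicit Types (f g : R -> R) (delta : R).

Definition tube f delta : set (R * R) := [set z | `|z.2 - f z.1| <= delta].

Lemma half_tube f delta (z : R * R) : tube f delta z ->
  exists b : bool, tube (fun x => f x + (-1) ^+ b * (delta / 2)) (delta / 2) z.
Proof.
rewrite /tube /= => zf; have [h|h] := leP 0 (z.2 - f z.1).
  exists false; move: zf; rewrite ger0_norm// expr0 mul1r => zf.
  by rewrite ler_norml; apply/andP; split; lra.
exists true; move: zf; rewrite ltr0_norm// expr1 mulN1r => zf.
by rewrite ler_norml; apply/andP; split; lra.
Qed.

Context d (T : measurableType d) (P : probability T R) (K : T -> set (R * R)).
Hypothesis K01 : forall w, fst @` K w `<=` `[0, 1].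

Definition uncountable_hit f delta : set T :=
  [set w | ~ countable (fst @` (K w `&` tube f delta))].

(** Over each core where A is uncountable, one of the half-tubes has an
uncountable projection; let b record which.  A sign vector that agrees with b
on one of these cores moves the centre of the tube to the centre of that
half-tube. *)
Lemma uncountable_hit_wave m p N f delta w :
  let A := fst @` (K w `&` tube f delta) in
  (N <= nb_uncountable m (core m p) A)%N ->
  (2 ^ m - 2 ^ (m - N) <= #|[pred s : {ffun 'I_m -> bool} |
     `[< uncountable_hit (fun x => f x + wave p s x * (delta / 2))%R
           (delta / 2) w >]]|)%N.
Proof.
move=> A NA.
pose half (b : bool) j := fst @` (K w `&` tube f delta
  `&` tube (fun x => f x + (-1) ^+ b * (delta / 2)) (delta / 2)) `&` @core R m p j.
have H (j : 'I_m) : exists b, ~ countable (A `&` core m p j) ->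
    ~ countable (half b j).
  have [cA|ncA] := pselect (countable (A `&` core m p j)); first by exists true.
  suff [b ncb] : exists b, ~ countable (half b j) by exists b.
  apply: uncountable_bigcup; apply: uncountable_sub ncA.
  move=> x [[z [Kz fz] zx] xj]; have [b bz] := half_tube fz.
  by exists b => //; split => //; exists z.
have {H}[b Hb] := choice H.
apply: leq_trans (card_sign_match b NA) _.
apply/subset_leq_card/fintype.subsetP => s; rewrite !inE => /existsP[j].
rewrite !inE => /andP[/asboolP/Hb nch /eqP sj].
apply: (uncountable_sub _ nch) => _ [[z [[Kz _] bz] <-] xj].
by exists z => //; split => //; rewrite /tube /= (wave_core s xj) sj.
Qed.

(** The loss c - c' is spent in three equal parts e: on fixing the number m of
cells, on fixing the width p of the transitions, and on the fraction 2^-N of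
sign vectors that miss. *)
Lemma refine c c' f delta : 0 <= delta -> c' < c -> continuous f ->
  outer_ge P c (uncountable_hit f delta) ->
  exists g, [/\ continuous g, forall x, `|g x - f x| <= delta / 2 &
                outer_ge P c' (uncountable_hit g (delta / 2))].
Proof.
move=> delta0 c'c cf hitf.
pose e := (c - c') / 3%:R.
have e0 : 0 < e by rewrite divr_gt0// subr_gt0.
have [N Ne] : exists N, 2 ^- N <= e.
  exists (Num.truncn e^-1); rewrite -[leRHS]invrK lef_pV2 ?posrE ?exprn_gt0 ?invr_gt0//.
  rewrite (le_trans (ltW (truncnS_gt _)))// -natrX ler_nat.
  exact: ltn_expl.
pose A w := fst @` (K w `&` tube f delta).
have A01 w : A w `<=` `[0, 1].
  by move=> x [z [Kz _] zx]; apply: (K01 (w := w)); exists z.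
have [m Nm hitm] : exists2 m, (N <= m)%N & outer_ge P (c - e)
    [set w | (N <= nb_uncountable m (cell m) (A w))%N].
  pose E m0 := [set w | forall m, (m0 <= m)%N ->
    (N <= nb_uncountable m (cell m) (A w))%N].
  have [|||m hitm] := @outer_ge_bigcup _ _ _ P c (c - e) E.
  - by rewrite ltrBlDr ltrDl.
  - move=> m m' mm'; apply/subsetPset => w Ew k m'k; apply: Ew.
    exact: leq_trans m'k.
  - apply: outer_ge_sub hitf => w hw.
    by have [m0 Hm0] := nb_uncountable_cells N (@A01 w) hw; exists m0.
  (* m >= N makes the truncated exponent in 2 ^ (m - N) exact. *)
  exists (maxn m N); first exact: leq_maxr.
  by apply: outer_ge_sub hitm => w; apply; exact: leq_maxl.
have [p hitp] : exists p, outer_ge P (c - e - e)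
    [set w | (N <= nb_uncountable m (core m p) (A w))%N].
  apply: (@outer_ge_bigcup _ _ _ _ (c - e)).
  - by rewrite ltrBlDr ltrDl.
  - move=> p q pq; apply/subsetPset => w /=.
    by move=> /leq_trans; apply; exact: le_nb_uncountable_core.
  - apply: outer_ge_sub hitm => w /= hw.
    by have [p Hp] := nb_uncountable_cores m (A w); exists p => //=; exact: leq_trans Hp.
have cardI : #|{: {ffun 'I_m -> bool}}| = (2 ^ m)%N.
  by rewrite card_ffun card_bool card_ord.
have [|| s hits] := outer_ge_average (c' := c') _ hitp
  (fun w => @uncountable_hit_wave m p N f delta w).
- by rewrite cardI expn_gt0.
- rewrite cardI natrB ?leq_pexp2l ?leq_subr// !natrX.
  rewrite exprB ?unitfE ?pnatr_eq0// mulrC -subr_ge0.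
  have -> : (2 ^+ m - 2 ^+ m / 2 ^+ N) * (c - e - e) - 2 ^+ m * c' =
      2 ^+ m * (e - 2 ^- N * (c - e - e)) by rewrite /e; field; rewrite expf_neq0.
  rewrite mulr_ge0 ?exprn_ge0// subr_ge0 (le_trans _ Ne)//.
  by rewrite ler_piMr ?invr_ge0 ?exprn_ge0// (outer_ge_le1 hitp).
exists (fun x => f x + wave p s x * (delta / 2)); split => //.
- move=> x; apply: cvgD; first exact: cf.
  by apply: cvgM; [exact: wave_continuous|exact: cvg_cst].
- move=> x; rewrite addrAC subrr add0r normrM [`|delta / 2|]ger0_norm; last by lra.
  by rewrite ler_piMl ?wave_le1//; lra.
Qed.

End Refinement.

(** * Limits of nested tubes *)

Section Limit.
Variable R : realType.
Implicit Types (f g : R -> R) (delta : R).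

Definition dyadic n : R := 2^-1 ^+ n.+1.

Lemma dyadic_gt0 n : 0 < dyadic n.
Proof. by rewrite exprn_gt0// invr_gt0. Qed.

Lemma dyadicS n : dyadic n = dyadic n.+1 + dyadic n.+1.
Proof. by rewrite /dyadic [_ ^+ n.+2]exprS; field. Qed.

Lemma dyadic_half n : dyadic n / 2 = dyadic n.+1.
Proof. by rewrite [dyadic n]dyadicS; field. Qed.

Lemma dyadic_small e : 0 < e -> exists n, dyadic n < e.
Proof.
move=> e0; exists (Num.truncn e^-1); rewrite /dyadic exprVn.
rewrite -[ltRHS]invrK ltf_pV2 ?posrE ?exprn_gt0 ?invr_gt0//.
rewrite (lt_le_trans (truncnS_gt _))// -natrX ler_nat.
exact/ltnW/ltn_expl.
Qed.

(** The lower ends f n x - dyadic n increase with n and stay below all the upper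
ends f n x + dyadic n, so their supremum lies in every tube. *)
Lemma dyadic_limit (f : nat -> R -> R) : (forall n, continuous (f n)) ->
  (forall n x, `|f n.+1 x - f n x| <= dyadic n.+1) ->
  exists2 g, continuous g & forall n x, `|g x - f n x| <= dyadic n.
Proof.
move=> cf df.
have tele n k x : `|f (n + k)%N x - f n x| <= dyadic n - dyadic (n + k).
  elim: k => [|k IH]; first by rewrite addn0 !subrr normr0.
  rewrite addnS -(subrKA (f (n + k)%N x)) (le_trans (ler_normD _ _))//.
  by have := df (n + k)%N x; have := dyadicS (n + k); lra.
pose S x := range (fun n => f n x - dyadic n).
have Sub n x : ubound (S x) (f n x + dyadic n).
  move=> _ [m _ <-]; have dn := dyadic_gt0 n; have dm := dyadic_gt0 m.
  have [/subnKC mn|/ltnW /subnKC nm] := leqP m n.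
    by have := tele m (n - m)%N x; rewrite mn ler_norml => /andP[]; lra.
  by have := tele n (m - n)%N x; rewrite nm ler_norml => /andP[]; lra.
have gf n x : `|sup (S x) - f n x| <= dyadic n.
  have Su : sup (S x) <= f n x + dyadic n.
    by apply: ge_sup => //; exists (f 0%N x - dyadic 0); exists 0%N.
  have Sl : f n x - dyadic n <= sup (S x).
    by apply: ub_le_sup; [exists (f n x + dyadic n)|exists n].
  by rewrite ler_norml; apply/andP; split; lra.
exists (fun x => sup (S x)) => // x; apply/cvgrPdist_lt => e e0.
have [n ne] : exists n, dyadic n < e / 3 by apply: dyadic_small; rewrite divr_gt0.
have /cvgrPdist_lt/(_ _ (divr_gt0 e0 (ltr0Sn R 2))) := cf n x.
apply: filterS => y; have := gf n x; have := gf n y.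
rewrite !ler_norml !ltr_norml => /andP[? ?] /andP[? ?] /andP[? ?].
by apply/andP; split; lra.
Qed.

Lemma tube_dist_continuous f : continuous f ->
  continuous (fun z : R * R => `|z.2 - f z.1|).
Proof.
move=> cf z; apply: (@continuous_comp _ _ _ (fun z : R * R => z.2 - f z.1) Num.norm).
  apply: cvgB; first exact: cvg_snd.
  by apply: (@continuous_comp _ _ _ (@fst R R) f); [exact: cvg_fst|exact: cf].
exact: norm_continuous.
Qed.

Lemma unit_square_compact : compact (@unit_square R).
Proof. by apply: compact_setX; exact: segment_compact. Qed.

Lemma tube_compact f delta : continuous f -> compact (@unit_square R `&` tube f delta).
Proof.
move=> cf; apply: subclosed_compact unit_square_compact _; last exact: subIsetl.
apply: closedI; first by apply: compact_closed => //; exact: unit_square_compact.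
apply: (@preimage_closed _ _ (fun z : R * R => `|z.2 - f z.1|) [set r | r <= delta]).
  by move=> z _; exact: tube_dist_continuous.
exact: closed_le.
Qed.

Lemma graph01E f : (forall x, x \in `[0, 1] -> f x \in `[0, 1]) ->
  graph01 f = @unit_square R `&` tube f 0.
Proof.
move=> f01; apply/seteqP; split => [_ [x x01 <-]|[x y] [[/= x01 y01]]].
  split; last by rewrite /tube /= subrr normr0.
  by split => //=; apply: f01.
by rewrite /tube /= normr_le0 subr_eq0 => /eqP ->; exists x.
Qed.

End Limit.

(** * Hitting events of a random compact set *)

Section Hitting.
Context (R : realType) d (T : measurableType d) (P : probability T R).
Variable K : {RV P >-> compact_subset_space R}.
Implicit Types (f g : R -> R) (delta : R).

Let Kset w : set (R * R) := (K w : compact_subset R).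

Lemma Kset_sub w : Kset w `<=` @unit_square R.
Proof. exact: compact_subset_sub. Qed.

Lemma Kset_compact w : compact (Kset w).
Proof. exact: compact_subset_compact. Qed.

Definition hit (F : set (R * R)) : set T := [set w | Kset w `&` F !=set0].

Lemma measurable_hit F : compact F -> F `<=` @unit_square R -> measurable (hit F).
Proof.
move=> cF F1; rewrite -[hit F]setTI.
apply: (measurable_funPT K measurableT [set C : compact_subset R | C `&` F !=set0]).
by apply: sub_sigma_algebra; exists F.
Qed.

Lemma measurable_hit_tube f delta : continuous f ->
  measurable (hit (@unit_square R `&` tube f delta)).
Proof. by move=> cf; apply: measurable_hit; [exact: tube_compact|exact: subIsetl]. Qed.

(** The vertical distance to the graph of f attains its minimum on the compact
set K w, and this minimum is at most dyadic n for all n. *)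
Lemma hit_graph f : continuous f ->
  \bigcap_n hit (@unit_square R `&` tube f (dyadic R n))
    `<=` hit (@unit_square R `&` tube f 0).
Proof.
move=> cf w hw.
have K0 : Kset w !=set0 by have [z []] := hw 0%N Logic.I; exists z.
have [z /set_mem Kz zmin] := compact_EVT_min K0 (@Kset_compact w)
  (continuous_subspaceT (tube_dist_continuous cf)).
exists z; split => //; split; first exact: Kset_sub Kz.
rewrite /tube /= leNgt; apply/negP => /dyadic_small[n].
have [z' [Kz' [_ z'n]]] := hw n Logic.I.
by apply/negP; rewrite -leNgt (le_trans (zmin z' _))// inE.
Qed.

Lemma hit_graph_prob f c : continuous f ->
  (forall n, (c%:E <= P (hit (@unit_square R `&` tube f (dyadic R n))))%E) ->
  (c%:E <= P (hit (@unit_square R `&` tube f 0)))%E.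
Proof.
move=> cf hc; set H := fun n => hit (@unit_square R `&` tube f (dyadic R n)).
have mH n : measurable (H n) by exact: measurable_hit_tube.
have mI : measurable (\bigcap_n H n) by exact: bigcapT_measurable.
apply: (@le_trans _ _ (P (\bigcap_n H n))); last first.
  by apply: le_measure; rewrite ?inE//; [exact: measurable_hit_tube|exact: hit_graph].
have ni : nonincreasing_seq H.
  apply/nonincreasing_seqP => n; apply/subsetPset => w [z [Kz [z1 zn]]].
  exists z; split => //; split => //; apply: le_trans zn _.
  by rewrite [leRHS]dyadicS lerDl ltW// dyadic_gt0.
have H0 : (P (H 0%N) < +oo)%E.
  exact: le_lt_trans (probability_le1 P (mH 0%N)) (ltry _).
have cvgH := nonincreasing_cvg_mu (mu := P) H0 mH mI ni.
rewrite -(cvg_lim _ cvgH)//; apply: lime_ge; last exact: nearW.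
by apply/cvg_ex; eexists; exact: cvgH.
Qed.

End Hitting.

Theorem mainTheorem1 (R : realType) (d : measure_display)
    (T : measurableType d) (P : probability T R)
    (K : {RV P >-> compact_subset_space R}) :
  {ae P, forall w : T,
     ~ countable (fst @` (K w : compact_subset R) : set R)} ->
  forall eps : R, 0 < eps ->
  exists f : R -> R,
    [/\ {within `[0, 1], continuous f},
        (forall x : R, x \in `[0, 1] -> f x \in `[0, 1]) &
        ((1 - eps)%:E <=
           P [set w : T | (K w : compact_subset R) `&` graph01 f !=set0])%E].
Proof.
move=> aeK eps eps0.
pose Kset w : set (R * R) := (K w : compact_subset R).
have Ksq w : Kset w `<=` @unit_square R by exact: Kset_sub.
have K01 w : fst @` Kset w `<=` `[0, 1] by move=> _ [z /Ksq[z1 _] <-].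
pose c n : R := 1 - eps + eps * 2^-1 ^+ n.
pose good n f := continuous f /\ outer_ge P (c n) (uncountable_hit Kset f (dyadic R n)).
have next_exists (nf : nat * (R -> R)) : exists g, good nf.1 nf.2 ->
    good nf.1.+1 g /\ forall x, `|g x - nf.2 x| <= dyadic R nf.1.+1.
  case: nf => n f /=; have [[cf hf]|] := pselect (good n f); last by exists f.
  have cn : c n.+1 < c n.
    by rewrite ltrD2l ltr_pM2l// exprS gtr_pMl ?exprn_gt0 ?invr_gt0// invf_lt1 ?ltr1n.
  have [g []] := refine K01 (ltW (dyadic_gt0 R n)) cn cf hf.
  by rewrite dyadic_half => cg gf hg; exists g.
have [next nextP] := choice next_exists.
pose f := fix f n := if n is n'.+1 then next (n', f n') else cst 2^-1 : R -> R.
have fgood n : good n (f n).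
  elim: n => [|n IH]; last by have [] := nextP (n, f n) IH.
  (* The tube of centre and radius 1/2 contains the unit square, so the
     invariant starts with outer probability 1 = c 0. *)
  split; first exact: cst_continuous.
  move=> B mB UB; rewrite /c expr0 mulr1 subrK.
  have [N [mN N0 NK]] := aeK.
  have BN : setT `<=` B `|` N.
    move=> w _; have [Bw|nBw] := pselect (B w); [by left|right].
    apply: NK => /= ncK; apply: nBw; apply: UB; apply: (uncountable_sub _ ncK).
    move=> _ [z Kz <-]; exists z => //; split => //.
    have [_] := Ksq _ _ Kz; rewrite /= in_itv /= => /andP[z0 z1].
    by rewrite /tube /dyadic /= expr1 ler_norml; apply/andP; split; lra.
  rewrite -(probability_setT P) (@le_trans _ _ (P (B `|` N)))//.
    by apply: le_measure; rewrite ?inE//; exact: measurableU.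
  rewrite (le_trans (measureU2 _ mB mN))//.
  by rewrite [X in _ + X]N0 adde0.
have [g cg gf] : exists2 g : R -> R, continuous g &
    forall n x, `|g x - f n x| <= dyadic R n.
  apply: dyadic_limit => [n|n x]; first by case: (fgood n).
  by have [_] := nextP (n, f n) (fgood n); apply.
have g01 x : x \in `[0, 1] -> g x \in `[0, 1].
  move=> _; have := gf 0%N x; rewrite /dyadic expr1 /= ler_norml in_itv /=.
  by move=> /andP[? ?]; apply/andP; split; lra.
clearbody f.
exists g; split => //; first exact: continuous_subspaceT.
rewrite graph01E//; apply: hit_graph_prob => // n.
(* The tube of radius dyadic n.+1 around f n.+1 lies within dyadic n of g. *)
have [_ hn] := fgood n.+1.
apply: (@le_trans _ _ (c n.+1)%:E).
  by rewrite lee_fin lerDl mulr_ge0 ?exprn_ge0 ?invr_ge0// ltW.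
apply: hn; first exact: measurable_hit_tube.
move=> w hw.
have [_ [z [Kz fz] _]] : fst @` (Kset w `&` tube (f n.+1) (dyadic R n.+1)) !=set0.
  by apply/set0P/eqP => E; apply: hw; rewrite E.
exists z; split => //; split; first exact: Ksq Kz.
rewrite /tube /= in fz *; rewrite [leRHS]dyadicS.
move: fz (gf n.+1 z.1).
by rewrite !ler_norml => /andP[? ?] /andP[? ?]; apply/andP; split; lra.
Qed.
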